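(* Let $H$ be an $r$-uniform hypergraph on a finite vertex set $V$. For $r/2<s\le r-1$ and $X,Y\subseteq V^{\underline{s}}$, if $H$ is $s$-connected, then $$d^{(s)}(X,Y)\le\left\lfloor\frac{\log\frac{\mathrm{vol}(\bar X)\,\mathrm{vol}(\bar Y)}{\mathrm{vol}(X)\,\mathrm{vol}(Y)}}{\log\frac{2}{2-\lambda_1^{(s)}}}\right\rfloor+1,$$ where $\lambda_1^{(s)}$ is the first non-trivial eigenvalue of the Laplacian of $D^{(s)}$ and $\mathrm{vol}(\cdot)$ are volumes in $D^{(s)}$.
   Context: $V^{\underline{s}}$ is the set of ordered $s$-tuples of distinct elements of $V$; for $x\in V^{\underline{s}}$, $[x]$ is the $s$-set of its coordinates. An $r$-uniform hypergraph $H$ has edge set $E(H)\subseteq\binom{V}{r}$. For $S\subseteq V$ with $|S|<r$, $d_S$ is the number of edges containing $S$. An $s$-walk of length $k$ is a sequence of vertices $v_1,\dots,v_{(r-s)(k-1)+r}$ such that $F_i=\{v_{(r-s)(i-1)+1},\dots,v_{(r-s)(i-1)+r}\}$ is an edge of $H$ for $1\le i\le k$. Its $i$-th stop ($0\le i\le k$) is the ordered $s$-tuple $x_i=(v_{(r-s)i+1},\dots,v_{(r-s)i+s})$; it starts at $x_0$ and ends at $x_k$. It is an $s$-path if all its stops are different. The $s$-distance $d^{(s)}(x,y)$ is the minimum length of an $s$-path from $x$ to $y$; $d^{(s)}(X,Y)=\min\{d^{(s)}(x,y):x\in X,y\in Y\}$. $H$ is $s$-connected if $d^{(s)}(x,y)$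 is finite for all $x,y\in V^{\underline{s}}$. For $r/2<s\le r-1$, $D^{(s)}$ is the directed graph on $V^{\underline{s}}$ in which $(x,y)$ is an edge iff $x_{r-s+j}=y_j$ for $1\le j\le 2s-r$ and $[x]\cup[y]\in E(H)$. Each $x$ has out-degree and in-degree both equal to $d_x=d_{[x]}(r-s)!$, so $D^{(s)}$ is Eulerian; the $s$-distance in $H$ equals the directed distance in $D^{(s)}$. Let $A$ be the adjacency matrix of $D^{(s)}$, $T=\mathrm{diag}(d_x)$, and $\vec{\mathcal L}=I-T^{-1/2}AT^{-1/2}$, i.e. $\vec{\mathcal L}(x,y)=1$ if $x=y$, $-1/\sqrt{d_xd_y}$ if $(x,y)$ is an edge, and $0$ otherwise; the Laplacian of $D^{(s)}$ is $\mathcal L^{(s)}=(\vec{\mathcal L}+\vec{\mathcal L}^{\top})/2$, with eigenvalues listed in non-decreasing order as $\lambda_0^{(s)}\le\lambda_1^{(s)}\le\cdots$. For $X\subseteq V^{\underline{s}}$, $\mathrm{vol}(X)=\sum_{x\in X}d_x$ and $\bar X=V^{\underline{s}}\setminus X$.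
   Formalization: X and Y are taken nonempty, and either X and Y are disjoint or the right-hand side is assumed nonnegative: if X and Y meet, the distance is 0 while the right-hand side can be negative (complete 3-uniform H on 4 vertices, s=2, X=Y=all tuples but one). *)

(* Defs.v *)
From mathcomp Require Import all_boot all_order all_algebra.
From mathcomp Require Import all_classical all_reals all_analysis.
From mathcomp Require polyrcf.
Set Implicit Arguments.
Unset Strict Implicit.
Unset Printing Implicit Defensive.
Import Order.TTheory GRing.Theory Num.Theory.
Local Open Scope ring_scope.

(* A hypergraph on V is given by its edge set E : {set {set V}}. *)
Definition uniform (V : finType) (r : nat) (E : {set {set V}}) : Prop :=
  forall e, e \in E -> #|e| = r.

(* Ordered s-tuples of distinct elements of V. *)
Notation falling V s := {t : s.-tuple V | uniq t}.

Definition supp (V : finType) (s : nat) (x : falling V s) : {set V} :=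
  [set v in val x].

Definition codeg (V : finType) (E : {set {set V}}) (S : {set V}) : nat :=
  #|[set e in E | S \subset e]|.

Definition stop (V : finType) (r s : nat) (w : seq V) (i : nat) : seq V :=
  take s (drop ((r - s) * i) w).

(* For k >= 1 the length (r - s)(k - 1) + r of a walk equals (r - s)k + s,
   which also covers the walk of length 0, reduced to its only stop. *)
Definition is_walk (V : finType) (E : {set {set V}}) (r s k : nat)
    (w : seq V) : Prop :=
  size w = ((r - s) * k + s)%N /\
  forall i, (i < k)%N -> [set v in take r (drop ((r - s) * i) w)] \in E.

Definition is_path (V : finType) (E : {set {set V}}) (r s k : nat)
    (w : seq V) : Prop :=
  is_walk E r s k w /\ uniq [seq stop r s w i | i <- iota 0 k.+1].

Definition path_between (V : finType) (E : {set {set V}}) (r s k : nat)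
    (x y : falling V s) : Prop :=
  exists w : seq V,
    [/\ is_path E r s k w, stop r s w 0 = val x & stop r s w k = val y].

(* The infima below range over natural numbers, so they are minima, except
   that the infimum of the empty set is +oo. *)
Definition dist (R : realType) (V : finType) (E : {set {set V}}) (r s : nat)
    (x y : falling V s) : \bar R :=
  ereal_inf [set k%:R%:E | k in [set k | path_between E r k x y]]%classic.

Definition set_dist (R : realType) (V : finType) (E : {set {set V}})
    (r s : nat) (X Y : {set falling V s}) : \bar R :=
  ereal_inf [set dist R E r p.1 p.2 |
    p in [set p | p.1 \in X /\ p.2 \in Y]]%classic.

Definition s_connected (R : realType) (V : finType) (E : {set {set V}})
    (r s : nat) : Prop :=
  forall x y : falling V s, (dist R E r x y < +oo)%E.

(* Edges of D^(s): the last 2s - r entries of x are the first 2s - r entries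
   of y, in the same order. *)
Definition dedge (V : finType) (E : {set {set V}}) (r s : nat)
    (x y : falling V s) : bool :=
  (drop (r - s) (val x) == take (2 * s - r) (val y))
  && (supp x :|: supp y \in E).

Definition ddeg (V : finType) (E : {set {set V}}) (r s : nat)
    (x : falling V s) : nat :=
  (codeg E (supp x) * (r - s)`!)%N.

Definition vol (V : finType) (E : {set {set V}}) (r s : nat)
    (X : {set falling V s}) : nat :=
  (\sum_(x in X) ddeg E r x)%N.

Definition adjacency (R : realType) (V : finType) (E : {set {set V}})
    (r s : nat) : 'M[R]_#|{: falling V s}| :=
  \matrix_(i, j) (dedge E r (enum_val i) (enum_val j))%:R.

Definition inv_sqrt_deg (R : realType) (V : finType) (E : {set {set V}})
    (r s : nat) : 'M[R]_#|{: falling V s}| :=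
  diag_mx (\row_i (Num.sqrt (ddeg E r (enum_val i))%:R)^-1).

Definition dir_laplacian (R : realType) (V : finType) (E : {set {set V}})
    (r s : nat) : 'M[R]_#|{: falling V s}| :=
  1%:M - inv_sqrt_deg R E r s *m adjacency R E r s *m inv_sqrt_deg R E r s.

Definition laplacian (R : realType) (V : finType) (E : {set {set V}})
    (r s : nat) : 'M[R]_#|{: falling V s}| :=
  2^-1 *: (dir_laplacian R E r s + (dir_laplacian R E r s)^T).

(* Real eigenvalues in non-decreasing order, each repeated according to its
   multiplicity; for a symmetric matrix this is the whole spectrum.
   rootsR p is the increasing list of the distinct real roots of p. *)
Definition eigenvalues (R : realType) (n : nat) (M : 'M[R]_n) : seq R :=
  flatten [seq nseq (mup a (char_poly M)) a
          | a <- polyrcf.rootsR (char_poly M)].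

(* lambda_i^(s), counted from i = 0. *)
Definition lambda (R : realType) (V : finType) (E : {set {set V}})
    (r s i : nat) : R :=
  (eigenvalues (laplacian R E r s))`_i.

(* Main.v *)
Require Import Defs.
From mathcomp Require Import all_boot all_order all_algebra.
From mathcomp Require Import all_classical all_reals all_analysis.
From mathcomp Require Import complex spectral sesquilinear.
From mathcomp Require Import zify ring lra.
From mathcomp Require polyrcf.
Set Implicit Arguments.
Unset Strict Implicit.
Unset Printing Implicit Defensive.
Import Order.TTheory GRing.Theory Num.Theory.
Local Open Scope ring_scope.

(* An edge of D^(s) is one step of an s-walk, so it suffices to find a short
   walk from X to Y in D^(s), an Eulerian digraph.  Let N = T^(-1/2) A T^(-1/2)
   and M = (I + N) / 2.  Since N contracts the Euclidean norm, for every f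
   orthogonal to phi = T^(1/2) 1
     |f M|^2 = (|f|^2 + 2 <f N, f> + |f N|^2) / 4 <= |f|^2 - <f L, f> / 2
             <= (1 - lambda_1 / 2) |f|^2.
   Splitting T^(1/2) 1_X and T^(1/2) 1_Y along phi then shows that
   <(T^(1/2) 1_X) M^k, T^(1/2) 1_Y> is nonzero as soon as
     (1 - lambda_1 / 2)^k vol(~X) vol(~Y) < vol(X) vol(Y),
   in which case some walk of length at most k leads from X to Y.  Connectivity
   enters through lambda_1 > 0: the kernel of L is spanned by phi. *)

(** * Spectra of real symmetric matrices *)

Lemma char_poly_similar (F : fieldType) n (A D P : 'M[F]_n) :
  P \in unitmx -> A = invmx P *m D *m P -> char_poly A = char_poly D.
Proof.
move=> Pu ->; rewrite /char_poly /char_poly_mx.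
have XE : 'X%:M = map_mx polyC (invmx P) *m 'X%:M *m map_mx polyC P :> 'M[_]_n.
  by rewrite mul_mx_scalar -scalemxAl -map_mxM mulVmx // map_mx1 scalemx1.
rewrite {1}XE !map_mxM -mulmxBl -mulmxBr !det_mulmx !det_map_mx.
by rewrite mulrAC -rmorphM -det_mulmx mulVmx // det1 mul1r.
Qed.

Section Eigenvalues.
Variables (R : realType) (n : nat) (A : 'M[R]_n).

Lemma eigenvalues_sorted : sorted <=%R (eigenvalues A).
Proof.
rewrite sorted_pairwise; last exact: le_trans.
have : sorted <%R (polyrcf.rootsR (char_poly A)) by exact: polyrcf.sorted_roots.
rewrite sorted_pairwise; last exact: lt_trans.
rewrite /eigenvalues; elim: (polyrcf.rootsR _) => //= a s IHs /andP[/allP as_ /IHs ss].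
rewrite pairwise_cat ss andbT; apply/andP; split.
  apply/allrelP => x y /nseqP[-> _] /flattenP[_ /mapP[b bs ->] /nseqP[-> _]].
  exact/ltW/as_.
by elim: (mup _ _) => //= m ->; rewrite all_nseq lexx orbT.
Qed.

(** In both lists the number of copies of [a] is its multiplicity as a root of the characteristic
    polynomial. *)
Lemma perm_eigenvalues (d : seq R) :
  char_poly A = \prod_(a <- d) ('X - a%:P) -> perm_eq (eigenvalues A) d.
Proof.
move=> Ad; apply/allP => a _ /=; apply/eqP.
rewrite -(mu_prod_XsubC a d) -Ad /eigenvalues.
have p0 : char_poly A != 0 by rewrite monic_neq0 ?char_poly_monic.
have /(_ a) := polyrcf.roots_on_rootsR p0; rewrite in_itv /=.
have : uniq (polyrcf.rootsR (char_poly A)) by exact: polyrcf.uniq_roots.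
rewrite count_flatten -map_comp sumnE big_map.
have [aR|aR] := boolP (a \in polyrcf.rootsR (char_poly A)) => sU.
  move=> _; rewrite (bigD1_seq a) //= count_nseq /= eqxx mul1n big1 ?addn0 //.
  by move=> b /negPf ba; rewrite /= count_nseq /= ba.
move=> aroot; rewrite mupNroot ?aroot // big_seq big1 // => b bR.
by rewrite /= count_nseq /=; case: eqP => // ba; rewrite -ba bR in aR.
Qed.

End Eigenvalues.

Section SymmetricMatrix.
Local Open Scope sesquilinear_scope.

(** Over [R[i]] the matrix is Hermitian, so the complex spectral theorem applies. Its spectrum is
    real: the eigenvalues are brought back to [R], while the eigenbasis [U] stays complex. *)
Lemma sym_spectral (R : rcfType) n (A : 'M[R]_n) : A^T = A ->
  exists (d : 'rV[R]_n) (U : 'M[R[i]]_n),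
  [/\ U \is unitarymx,
      map_mx (real_complex R) A
        = U ^t* *m map_mx (real_complex R) (diag_mx d) *m U
    & char_poly A = \prod_i ('X - (d 0 i)%:P)].
Proof.
move=> AT; pose toC := real_complex R; pose AC := map_mx toC A.
have realC x : toC x \is Num.real.
  by apply/complex_realP; exists x.
have ACh : AC \is hermsymmx.
  apply: realsym_hermsym; last by apply/mxOverP => i j; rewrite mxE.
  apply/is_hermitianmxP; rewrite expr0 scale1r; apply/matrixP => i j.
  by rewrite !mxE -[in LHS]AT mxE.
have Uu := spectral_unitarymx AC.
have ACE : AC = _ := orthomx_spectralP (hermitian_normalmx ACh).
have Dreal := hermitian_spectral_diag_real ACh.
set U := spectralmx AC in Uu ACE; set D := spectral_diag AC in ACE Dreal.
pose d : 'rV[R]_n := \row_i complex.Re (D 0 i).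
have dE : map_mx toC (diag_mx d) = diag_mx D.
  rewrite map_diag_mx; congr diag_mx; apply/rowP => i; rewrite !mxE.
  by have /mxOverP/(_ 0 i)/complex_realP[a ->] := Dreal.
exists d, U; split=> //; first by rewrite dE -invmx_unitary.
apply: (map_inj_poly (@complexI R) (rmorph0 toC)) => /=.
rewrite map_char_poly (char_poly_similar (unitarymx_unit Uu) ACE) -dE.
rewrite -map_char_poly; congr map_poly.
rewrite char_poly_trig; last exact: diag_mx_is_trig.
by apply: eq_bigr => i _; rewrite !mxE eqxx.
Qed.

End SymmetricMatrix.

Lemma row_sqr_gt0 (R : realDomainType) n (v : 'rV[R]_n) : v != 0 -> 0 < (v *m v^T) 0 0.
Proof.
move=> v0; rewrite mxE lt_neqAle sumr_ge0 ?andbT; last first.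
  by move=> i _; rewrite mxE -expr2 sqr_ge0.
apply: contraNneq v0 => /esym/eqP; rewrite psumr_eq0; last first.
  by move=> i _; rewrite mxE -expr2 sqr_ge0.
move=> /allP v0; apply/eqP/rowP => i; rewrite [RHS]mxE; apply/eqP.
by have := v0 i (mem_index_enum i); rewrite mxE mulf_eq0 orbb.
Qed.

(** * Rayleigh bound on the complement of a one-dimensional kernel *)

Section SpectralGap.
Local Open Scope sesquilinear_scope.
Variables (R : realType) (n : nat) (A : 'M[R]_n) (phi : 'rV[R]_n).
Hypotheses (AT : A^T = A) (phiA : phi *m A = 0) (phi0 : phi != 0).
Hypothesis A_ge0 : forall v : 'rV_n, 0 <= (v *m A *m v^T) 0 0.
Hypothesis kerA : forall v : 'rV_n, v *m A = 0 -> (v <= phi)%MS.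
Hypothesis n_gt1 : (1 < n)%N.

Local Notation toC := (real_complex R).

(** In the coordinates [w f] of the unitary eigenbasis both forms are sums of squared moduli.
    Exactly one eigenvalue is 0, because the kernel is the line of [phi], and a vector orthogonal to
    [phi] has no component there; the other eigenvalues are at least the second smallest. *)
Lemma spectral_gap : 0 < (eigenvalues A)`_1 /\
  forall f : 'rV_n, f *m phi^T = 0 ->
    (eigenvalues A)`_1 * (f *m f^T) 0 0 <= (f *m A *m f^T) 0 0.
Proof.
have [d [U [Uu AE pA]]] := sym_spectral AT.
pose w (f : 'rV[R]_n) := map_mx toC f *m U ^t*.
have UK : U *m U ^t* = 1%:M by apply/unitarymxP.
have KU : U ^t* *m U = 1%:M by rewrite -invmx_unitary // mulVmx // unitarymx_unit.
have wC f : (w f) ^t* = U *m map_mx toC f^T.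
  rewrite /w trmx_mul map_mxM trmxCK; congr (_ *m _).
  by apply/matrixP => i j; rewrite !mxE; apply/CrealP/complex_realP; eexists.
have normE f : toC ((f *m f^T) 0 0) = \sum_i `|w f 0 i| ^+ 2.
  transitivity ((w f *m (w f) ^t*) 0 0).
    by rewrite wC mulmxA -(mulmxA _ _ U) KU mulmx1 -map_mxM [in RHS]mxE.
  by rewrite mxE; apply: eq_bigr => i _; rewrite !mxE normCK.
have quadE f : toC ((f *m A *m f^T) 0 0) = \sum_i toC (d 0 i) * `|w f 0 i| ^+ 2.
  transitivity ((w f *m map_mx toC (diag_mx d) *m (w f) ^t*) 0 0).
    have -> : w f *m map_mx toC (diag_mx d) *m (w f) ^t*
        = map_mx toC f *m map_mx toC A *m map_mx toC f^T.
      by rewrite AE wC /w !mulmxA.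
    by rewrite -!map_mxM [in RHS]mxE.
  rewrite map_diag_mx mxE; apply: eq_bigr => i _.
  by rewrite mul_mx_diag !mxE normCK mulrCA mulrA.
have rowU i : row i U *m map_mx toC A = toC (d 0 i) *: row i U.
  rewrite AE !mulmxA -row_mul UK row1 map_diag_mx -rowE row_diag_mx.
  by rewrite -scalemxAl -rowE !mxE.
have d_ge0 i : 0 <= d 0 i.
  have : root (char_poly A) (d 0 i).
    by rewrite pA rootE horner_prod (bigD1 i) //= !hornerE subrr mul0r.
  rewrite -eigenvalue_root_char => /eigenvalueP[v vA v0].
  by have := A_ge0 v; rewrite vA -scalemxAl mxE pmulr_lge0 ?row_sqr_gt0.
(* The kernel hypothesis concerns real vectors while [row i U] is complex; the kernel matrix is
   formed over [R] and commutes with extension of scalars. *)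
have ker_row i : d 0 i = 0 -> exists a, row i U = a *: map_mx toC phi.
  move=> di; apply/sub_rVP; apply: (@submx_trans _ _ _ _ _ _ (map_mx toC (kermx A))).
    by rewrite map_kermx; apply/sub_kermxP; rewrite rowU di rmorph0 scale0r.
  rewrite map_submx; apply/row_subP => k; apply: kerA.
  by rewrite -row_mul mulmx_ker row0.
have dotU i j : (U *m U ^t*) i j = (row i U *m (row j U) ^t*) 0 0.
  by rewrite !mxE; apply: eq_bigr => k _; rewrite !mxE.
(* Two orthonormal rows cannot both be multiples of [phi]. *)
have ker_uniq i j : d 0 i = 0 -> d 0 j = 0 -> i = j.
  move=> /ker_row[a ai] /ker_row[b bj]; apply/eqP; apply: contraT => ij.
  have Ni := dotU i i; have Nj := dotU j j; have Nij := dotU i j.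
  move: Ni Nj Nij; rewrite UK ai bj !mxE !eqxx (negPf ij) /=.
  under eq_bigr do rewrite !mxE rmorphM mulrACA.
  under [in X in _ -> X -> _]eq_bigr do rewrite !mxE rmorphM mulrACA.
  under [in X in _ -> _ -> X -> _]eq_bigr do rewrite !mxE rmorphM mulrACA.
  rewrite -!mulr_sumr; set N := \sum_k _ => Ni Nj /esym/eqP.
  rewrite !mulf_eq0 conjC_eq0 -orbA => /or3P[] /eqP z.
  - by move: Ni => /eqP; rewrite z !mul0r oner_eq0.
  - by move: Nj => /eqP; rewrite z !mul0r oner_eq0.
  - by move: Nj => /eqP; rewrite z mulr0 oner_eq0.
(* Some coordinate of [phi] in the eigenbasis is nonzero, and [phi *m A = 0] makes the eigenvalue
   there vanish. *)
have [i0 di0] : exists i, d 0 i = 0.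
  have : w phi != 0.
    apply: contra phi0 => /eqP /(congr1 (mulmx^~ U)).
    by rewrite /w -mulmxA KU mulmx1 mul0mx => /eqP; rewrite map_mx_eq0.
  move=> /rV0Pn[i wi]; exists i.
  have /matrixP/(_ 0 i) : w phi *m map_mx toC (diag_mx d) = 0.
    have : map_mx toC (phi *m A) *m U ^t* = 0 by rewrite phiA map_mx0 mul0mx.
    by rewrite map_mxM AE !mulmxA -(mulmxA _ U) UK mulmx1.
  rewrite map_diag_mx mul_mx_diag !mxE => /eqP; rewrite mulf_eq0.
  move: wi; rewrite /w mxE => /negPf -> /= /eqP.
  exact: (@complexI R).
(* One zero is split off the spectrum, so that the entry of index 1 in the sorted list is the
   minimum of [rest]. *)
pose rest := [seq d 0 i | i <- rem i0 (enum 'I_n)].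
have restP a : a \in rest -> exists2 i, i != i0 & a = d 0 i.
  move=> /mapP[j]; rewrite mem_rem_uniq ?enum_uniq // !inE.
  by case/andP=> ji0 _ ->; exists j.
have sorted_e := eigenvalues_sorted A.
have perm_e : perm_eq (eigenvalues A) (0 :: rest).
  apply: (@perm_trans _ [seq d 0 i | i <- enum 'I_n]).
    by apply: perm_eigenvalues; rewrite big_map big_enum.
  by rewrite -[X in X :: rest]di0 -map_cons perm_map // perm_to_rem ?mem_enum.
have e_ge0 a : a \in eigenvalues A -> 0 <= a.
  by rewrite (perm_mem perm_e) inE => /predU1P[->//|/restP[i _ ->]].
have sr : size rest = n.-1 by rewrite size_map size_rem ?mem_enum // size_enum_ord.
have [e eE] : exists e, eigenvalues A = 0 :: e.
  have := perm_mem perm_e 0; rewrite mem_head.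
  case: (eigenvalues A) sorted_e e_ge0 => // a e ae a_ge0.
  rewrite inE => /predU1P[->|e0]; first by exists e.
  exists e; congr (_ :: _); apply/le_anti; rewrite a_ge0 ?mem_head // andbT.
  by have /allP := order_path_min le_trans ae; apply.
move: perm_e sorted_e; rewrite eE perm_cons => perm_e /path_sorted sorted_e /=.
have : size e = n.-1 by rewrite (perm_size perm_e).
case: e perm_e sorted_e {eE} => [|a e] perm_e sorted_e /=; first by lia.
move=> _.
have a_min i : i != i0 -> a <= d 0 i.
  move=> ii0; have : d 0 i \in a :: e.
    rewrite (perm_mem perm_e); apply: map_f.
    by rewrite mem_rem_uniq ?enum_uniq // !inE ii0 mem_enum.
  rewrite inE => /predU1P[->//|ie].
  by have /allP := order_path_min le_trans sorted_e; apply.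
split.
  have : a \in rest by rewrite -(perm_mem perm_e) mem_head.
  case/restP=> i ii0 ->; rewrite lt_neqAle d_ge0 andbT.
  by apply: contraNneq ii0 => di; rewrite (ker_uniq i i0) // ?eqxx.
move=> f fphi; rewrite -lecR rmorphM /= quadE normE mulr_sumr ler_sum // => i _.
have [->|ii0] := eqVneq i i0; last first.
  by rewrite ler_wpM2r ?exprn_ge0 // lecR a_min.
have [b bE] := ker_row _ di0.
suff -> : w f 0 i0 = 0 by rewrite normr0 expr0n !mulr0.
transitivity ((map_mx toC f *m (row i0 U) ^t*) 0 0).
  by rewrite !mxE; apply: eq_bigr => k _; rewrite !mxE.
have -> : (row i0 U) ^t* = b^* *: map_mx toC phi^T.
  rewrite bE; apply/matrixP => k l; rewrite !mxE rmorphM; congr (_ * _).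
  by apply/CrealP/complex_realP; eexists.
by rewrite -scalemxAr -map_mxM fphi map_mx0 scaler0 mxE.
Qed.

End SpectralGap.

(** * Lazy walks on Eulerian digraphs *)

(** Lagrange's identity: the difference of the two sides is half a double sum of squares. *)
Lemma sum_cauchy_schwarz (R : realFieldType) (I : finType) (x y : I -> R) :
  (\sum_i x i * y i) ^+ 2 <= (\sum_i x i ^+ 2) * (\sum_i y i ^+ 2).
Proof.
suff E : \sum_i \sum_j (x i * y j - x j * y i) ^+ 2
    = 2 * ((\sum_i x i ^+ 2) * (\sum_i y i ^+ 2) - (\sum_i x i * y i) ^+ 2).
  have : 0 <= \sum_i \sum_j (x i * y j - x j * y i) ^+ 2.
    by apply: sumr_ge0 => i _; apply: sumr_ge0 => j _; apply: sqr_ge0.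
  by rewrite E; lra.
transitivity (\sum_i \sum_j (x i ^+ 2 * y j ^+ 2 + y i ^+ 2 * x j ^+ 2
    - 2 * ((x i * y i) * (x j * y j)))).
  by apply: eq_bigr => i _; apply: eq_bigr => j _; ring.
under eq_bigr do rewrite sumrB big_split /= -!mulr_sumr.
rewrite sumrB big_split /= -!mulr_suml -mulr_sumr -mulr_suml.
ring.
Qed.

Section EulerianDigraph.
Variables (R : realType) (n : nat) (e : rel 'I_n) (d : 'I_n -> nat).
Hypothesis d_gt0 : forall i, (0 < d i)%N.
Hypothesis e_out : forall i, (\sum_j e i j)%N = d i.
Hypothesis e_in : forall j, (\sum_i e i j)%N = d j.
Hypothesis e_connect : forall i j, connect e i j.
Hypothesis n_gt1 : (1 < n)%N.

Let S : 'M[R]_n := diag_mx (\row_i (Num.sqrt (d i)%:R)^-1).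
Let N : 'M[R]_n := S *m (\matrix_(i, j) (e i j)%:R) *m S.
Let L : 'M[R]_n := 2^-1 *: ((1%:M - N) + (1%:M - N)^T).
Let phi : 'rV[R]_n := \row_i Num.sqrt (d i)%:R.
Let dot (f g : 'rV[R]_n) : R := \sum_i f 0 i * g 0 i.
Let half_step (f : 'rV[R]_n) : 'rV[R]_n := 2^-1 *: (f + f *m N).
(** Truncation at 0 makes multiplication by the rate monotone, so that the contraction estimate can
    be iterated. *)
Let rate : R := Num.max 0 (1 - (eigenvalues L)`_1 / 2).

Implicit Types f g h : 'rV[R]_n.

Let phi_gt0 i : 0 < phi 0 i.
Proof. by rewrite mxE sqrtr_gt0 ltr0n. Qed.

Let phi_neq0 i : phi 0 i != 0. Proof. by rewrite gt_eqF. Qed.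

Let sqr_phi i : phi 0 i ^+ 2 = (d i)%:R.
Proof. by rewrite mxE sqr_sqrtr ?ler0n. Qed.

Let NE i j : N i j = (e i j)%:R / (phi 0 i * phi 0 j).
Proof.
by rewrite /N /S mul_diag_mx mul_mx_diag !mxE invfM mulrA mulrAC mulrC mulrA.
Qed.

Let mx_dot f g : (f *m g^T) 0 0 = dot f g.
Proof. by rewrite mxE; apply: eq_bigr => i _; rewrite mxE. Qed.

Let sum_out i : \sum_j (e i j)%:R = (d i)%:R :> R.
Proof. by rewrite -natr_sum e_out. Qed.

Let sum_in j : \sum_i (e i j)%:R = (d j)%:R :> R.
Proof. by rewrite -natr_sum e_in. Qed.

(** Balance at each vertex: the in-degrees make [phi] a left fixed vector and, in [N_mulphi], the
    equal out-degrees make it a right one. *)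
Let phi_mulN : phi *m N = phi.
Proof.
apply/rowP => j; rewrite mxE.
transitivity (\sum_i (e i j)%:R / phi 0 j).
  by apply: eq_bigr => i _; rewrite NE; field; rewrite !phi_neq0.
by rewrite -mulr_suml sum_in -sqr_phi; field; rewrite phi_neq0.
Qed.

Let N_mulphi : N *m phi^T = phi^T.
Proof.
apply/colP => i; rewrite mxE [RHS]mxE.
transitivity (\sum_j (e i j)%:R / phi 0 i).
  by apply: eq_bigr => j _; rewrite NE [X in _ * X]mxE; field; rewrite !phi_neq0.
by rewrite -mulr_suml sum_out -sqr_phi; field; rewrite phi_neq0.
Qed.

Let L_sym : L^T = L.
Proof. by rewrite /L linearZ /= linearD /= trmxK addrC. Qed.

Let phi_mulL : phi *m L = 0.
Proof.
rewrite /L -scalemxAr mulmxDr mulmxBr mulmx1 phi_mulN subrr add0r.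
have -> : (1%:M - N)^T = 1%:M - N^T by rewrite linearB /= trmx1.
rewrite mulmxBr mulmx1 -[phi *m N^T]trmxK trmx_mul trmxK N_mulphi trmxK.
by rewrite subrr scaler0.
Qed.

(** A 1 by 1 matrix equals its transpose, so symmetrizing [N] leaves its quadratic form
    unchanged. *)
Let quadL f : (f *m L *m f^T) 0 0 = dot f f - dot (f *m N) f.
Proof.
have -> : f *m L *m f^T
    = 2^-1 *: ((f *m f^T - f *m N *m f^T) + (f *m f^T - (f *m N *m f^T)^T)).
  rewrite /L linearB /= trmx1 (trmx_mul (f *m N)) (trmx_mul f N) trmxK.
  rewrite -scalemxAr -scalemxAl.
  by rewrite mulmxDr !mulmxBr mulmx1 mulmxDl !mulmxBl mulmxA.
rewrite -!mx_dot; move: (f *m f^T) (f *m N *m f^T) => a b.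
by rewrite !mxE; field.
Qed.

Let dotNE f : dot (f *m N) f
  = \sum_i \sum_j (e i j)%:R * (f 0 i / phi 0 i * (f 0 j / phi 0 j)).
Proof.
rewrite exchange_big; apply: eq_bigr => j _; rewrite mxE mulr_suml.
by apply: eq_bigr => i _; rewrite NE; field; rewrite !phi_neq0.
Qed.

(** The square at each vertex is spread over its outgoing edges, and in [dot_in] over its incoming
    ones, so that the quadratic form of [L] becomes a sum over edges. *)
Let dot_out f : dot f f = \sum_i \sum_j (e i j)%:R * (f 0 i / phi 0 i) ^+ 2.
Proof.
apply: eq_bigr => i _; rewrite -mulr_suml sum_out -sqr_phi.
by field; rewrite phi_neq0.
Qed.

Let dot_in f : dot f f = \sum_i \sum_j (e i j)%:R * (f 0 j / phi 0 j) ^+ 2.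
Proof.
rewrite exchange_big; apply: eq_bigr => j _; rewrite -mulr_suml sum_in -sqr_phi.
by field; rewrite phi_neq0.
Qed.

Let dirichlet f : (f *m L *m f^T) 0 0
  = 2^-1 * \sum_i \sum_j (e i j)%:R * (f 0 i / phi 0 i - f 0 j / phi 0 j) ^+ 2.
Proof.
have -> : \sum_i \sum_j (e i j)%:R * (f 0 i / phi 0 i - f 0 j / phi 0 j) ^+ 2
    = dot f f + dot f f - 2 * dot (f *m N) f.
  rewrite {1}dot_out dot_in dotNE mulr_sumr -big_split -sumrB /=.
  apply: eq_bigr => i _; rewrite mulr_sumr -big_split -sumrB /=.
  by apply: eq_bigr => j _; ring.
by rewrite quadL; field.
Qed.

Let L_ge0 f : 0 <= (f *m L *m f^T) 0 0.
Proof.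
rewrite dirichlet mulr_ge0 ?invr_ge0 ?ler0n // sumr_ge0 // => i _.
by rewrite sumr_ge0 // => j _; rewrite mulr_ge0 ?ler0n ?sqr_ge0.
Qed.

(** A vanishing Dirichlet sum forces [f 0 i / phi 0 i] to agree at both ends of every edge, hence
    everywhere by connectivity. *)
Let ker_L f : f *m L = 0 -> (f <= phi)%MS.
Proof.
move=> fL; have := dirichlet f; rewrite fL mul0mx mxE => /esym/eqP.
rewrite mulf_eq0 invr_eq0 pnatr_eq0 /= psumr_eq0; last first.
  by move=> i _; rewrite sumr_ge0 // => j _; rewrite mulr_ge0 ?ler0n ?sqr_ge0.
move=> /allP f_edge.
have step i j : e i j -> f 0 i / phi 0 i = f 0 j / phi 0 j.
  move=> eij; have := f_edge i (mem_index_enum i); rewrite psumr_eq0 /=; last first.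
    by move=> k _; rewrite mulr_ge0 ?ler0n ?sqr_ge0.
  move=> /allP/(_ j (mem_index_enum j)); rewrite /= eij mul1r sqrf_eq0 subr_eq0.
  by move/eqP.
have const i j : f 0 i / phi 0 i = f 0 j / phi 0 j.
  have /connectP[p ip ->] := e_connect i j.
  by elim: p i ip => //= k p IHp i /andP[/step -> /IHp].
apply/sub_rVP; pose i0 := Ordinal (ltnW n_gt1).
exists (f 0 i0 / phi 0 i0); apply/rowP => i.
by rewrite mxE (const i0 i) divfK.
Qed.

(** Cauchy-Schwarz at each vertex [j] over its incoming edges: their number [d j] cancels against
    the normalization, and summing over [j] counts each [i] once per outgoing edge. *)
Let N_contract f : dot (f *m N) (f *m N) <= dot f f.
Proof.
rewrite (dot_out f) exchange_big; apply: ler_sum => j _.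
set g := fun i => f 0 i / phi 0 i.
(* The 0/1 weight is idempotent; it is doubled to give one copy to each factor of Cauchy-Schwarz. *)
have -> : (f *m N) 0 j = (\sum_i (e i j)%:R * ((e i j)%:R * g i)) / phi 0 j.
  rewrite mxE mulr_suml; apply: eq_bigr => i _; rewrite NE /g.
  by case: (e i j) => /=; field; rewrite !phi_neq0.
have := sum_cauchy_schwarz (fun i => (e i j)%:R) (fun i => (e i j)%:R * g i).
have -> : \sum_i (e i j)%:R ^+ 2 = phi 0 j ^+ 2.
  rewrite sqr_phi -sum_in; apply: eq_bigr => i _.
  by case: (e i j); rewrite ?expr1n ?expr0n.
have -> : \sum_i ((e i j)%:R * g i) ^+ 2 = \sum_i (e i j)%:R * g i ^+ 2.
  by apply: eq_bigr => i _; case: (e i j); rewrite ?mul1r ?mul0r ?expr0n.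
by rewrite -expr2 expr_div_n ler_pdivrMr ?exprn_gt0 // mulrC.
Qed.

Let phi_phi : dot phi phi = \sum_i (d i)%:R.
Proof. by apply: eq_bigr => i _; rewrite -expr2 sqr_phi. Qed.

Let phi_row_neq0 : phi != 0.
Proof.
by apply/rV0Pn; exists (Ordinal (ltnW n_gt1)); apply: phi_neq0.
Qed.

Let gap := spectral_gap L_sym phi_mulL phi_row_neq0 L_ge0 ker_L n_gt1.

Lemma digraph_lambda1_gt0 : 0 < (eigenvalues L)`_1.
Proof. by have [] := gap. Qed.

Let dotDl f g h : dot (f + g) h = dot f h + dot g h.
Proof. by rewrite -big_split; apply: eq_bigr => i _; rewrite mxE mulrDl. Qed.

Let dotZl a f h : dot (a *: f) h = a * dot f h.
Proof. by rewrite mulr_sumr; apply: eq_bigr => i _; rewrite mxE mulrA. Qed.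

Let dotC f g : dot f g = dot g f.
Proof. by apply: eq_bigr => i _; rewrite mulrC. Qed.

Let dotN_phi f : dot (f *m N) phi = dot f phi.
Proof. by rewrite -!mx_dot -mulmxA N_mulphi. Qed.

Let half_step_phi f : dot (half_step f) phi = dot f phi.
Proof. by rewrite dotZl dotDl dotN_phi; field. Qed.

Let half_step_contract f : dot f phi = 0 ->
  dot (half_step f) (half_step f) <= rate * dot f f.
Proof.
move=> fphi; rewrite dotZl dotC dotZl dotDl !(dotC _ (f + _)) !dotDl.
have fphi0 : f *m phi^T = 0.
  by apply/matrixP => i j; rewrite !ord1 mx_dot fphi mxE.
have [_ /(_ f fphi0)] := gap; rewrite quadL mx_dot => lf.
have := N_contract f; rewrite (dotC f (f *m N)) => Nf.
have ff : 0 <= dot f f by apply: sumr_ge0 => i _; rewrite -expr2 sqr_ge0.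
have : (1 - (eigenvalues L)`_1 / 2) * dot f f <= rate * dot f f.
  by rewrite ler_wpM2r // le_max lexx orbT.
by move=> ?; lra.
Qed.

Let iter_half_step k f : dot f phi = 0 ->
  dot (iter k half_step f) phi = 0 /\
  dot (iter k half_step f) (iter k half_step f) <= rate ^+ k * dot f f.
Proof.
move=> fphi; elim: k => [|k [IHphi IHk]]; first by rewrite expr0 mul1r.
rewrite iterS half_step_phi; split=> //.
apply: le_trans (half_step_contract IHphi) _.
by rewrite exprS -mulrA ler_wpM2l // le_max lexx.
Qed.

(** [half_step] is linear and fixes [phi], so the component along [phi] does not decay. *)
Let iter_half_stepD k a f :
  iter k half_step (a *: phi + f) = a *: phi + iter k half_step f.
Proof.
elim: k => //= k ->; rewrite /half_step mulmxDl -scalemxAl phi_mulN addrACA.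
rewrite scalerDr; congr (_ + _).
by rewrite -scalerDl scalerA; congr (_ *: _); field.
Qed.

(** The support spreads along one edge per step at most; a half step may also stay in place, whence
    length at most [k] rather than exactly [k]. *)
Let iter_half_step_path k f j : iter k half_step f 0 j != 0 ->
  exists i p, [/\ f 0 i != 0, path e i p, last i p = j & (size p <= k)%N].
Proof.
elim: k j => [|k IHk] j /=; first by exists j, [::].
set g := iter k _ _ in IHk *; rewrite /half_step mxE mulf_eq0 negb_or => /andP[_].
have [/IHk[i [p [fi ip pj pk]]] _|/negPn/eqP gj] := boolP (g 0 j != 0).
  by exists i, p; split=> //; apply: leq_trans pk _.
rewrite mxE gj add0r mxE => gN.
have [l] : exists l, g 0 l * N l j != 0.
  apply/existsP; apply: contraNT gN => /existsPn gN0.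
  by rewrite big1 // => l _; apply/eqP; have := gN0 l; rewrite negbK.
rewrite mulf_eq0 negb_or NE => /andP[/IHk[i [p [fi ip pl pk]]] elj].
exists i, (rcons p j); rewrite rcons_path last_rcons size_rcons ip pl; split=> //.
by move: elj; case: (e l j) => //; rewrite mul0r eqxx.
Qed.

Lemma digraph_short_path (X Y : {set 'I_n}) (k : nat) :
  Num.max 0 (1 - (eigenvalues L)`_1 / 2) ^+ k
    * ((\sum_(i in ~: X) d i)%:R * (\sum_(i in ~: Y) d i)%:R)
  < (\sum_(i in X) d i)%:R * (\sum_(i in Y) d i)%:R ->
  exists i p, [/\ i \in X, last i p \in Y, path e i p & (size p <= k)%N].
Proof.
pose u (Z : {set 'I_n}) : 'rV[R]_n := \row_i ((i \in Z)%:R * phi 0 i).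
pose vol (Z : {set 'I_n}) : R := (\sum_(i in Z) d i)%:R.
rewrite -/rate -/(vol X) -/(vol Y) -/(vol (~: X)) -/(vol (~: Y)) => vol_lt.
pose W := dot phi phi.
have W_gt0 : 0 < W by rewrite /W -mx_dot row_sqr_gt0.
have u_val Z i : u Z 0 i = (i \in Z)%:R * phi 0 i by rewrite [LHS]mxE.
have uu Z : dot (u Z) (u Z) = vol Z /\ dot (u Z) phi = vol Z.
  split; rewrite /vol natr_sum [RHS]big_mkcond; apply: eq_bigr => i _; rewrite !u_val.
    by case: (i \in Z); rewrite ?mul0r // mul1r -expr2 sqr_phi.
  by case: (i \in Z); rewrite ?mul0r // mul1r -expr2 sqr_phi.
have volC Z : vol Z + vol (~: Z) = W.
  rewrite /W phi_phi /vol -natrD -natr_sum; congr _%:R.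
  rewrite [RHS](bigID (mem Z)) /=; congr (_ + _)%N.
  by apply: eq_bigl => i; rewrite inE.
(* The part of [u Z] orthogonal to [phi]: [dot (u Z) phi] is [vol Z] and [dot phi phi] is [W]. *)
pose f Z := u Z - (vol Z / W) *: phi.
have uE Z : u Z = (vol Z / W) *: phi + f Z by rewrite addrC subrK.
have fphi Z : dot (f Z) phi = 0.
  have := (uu Z).2; rewrite {1}uE dotDl dotZl -/W divfK ?gt_eqF //.
  by move=> /eqP; rewrite -subr_eq0 addrAC subrr add0r => /eqP.
have ff Z : dot (f Z) (f Z) = vol Z * vol (~: Z) / W.
  have := (uu Z).1; rewrite {1 2}uE dotDl dotZl dotC dotDl dotZl -/W.
  rewrite [dot (f Z) (_ + _)]dotC dotDl dotZl (dotC phi) fphi.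
  have -> : vol (~: Z) = W - vol Z by rewrite -(volC Z) addrAC subrr add0r.
  move=> E; have -> : dot (f Z) (f Z) = vol Z - vol Z / W * (vol Z / W * W) by lra.
  by field; rewrite gt_eqF.
(* Without a short path, the iterate of [u X] and [u Y] have disjoint supports. *)
apply: contrapT => no_path.
have dot0 : dot (iter k half_step (u X)) (u Y) = 0.
  rewrite /dot big1 // => j _; apply/eqP; apply: contraT.
  rewrite mulf_eq0 negb_or u_val => /andP[/iter_half_step_path[i [p [ui ip pj pk]]]].
  rewrite u_val in ui; case Yj: (j \in Y); last by rewrite mul0r eqxx.
  case Xi: (i \in X) ui; last by rewrite mul0r eqxx.
  by case: no_path; exists i, p; rewrite pj.
have [gphi g_le] := iter_half_step k (fphi X).
set g := iter k half_step (f X) in gphi g_le.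
(* The components along [phi] contribute [vol X * vol Y / W] to the vanishing product, so the
   orthogonal parts must cancel it exactly. *)
have gf : dot g (f Y) = - (vol X * vol Y / W).
  have -> : dot g (f Y) = dot g (u Y).
    by rewrite [RHS]dotC {1}uE dotDl dotZl (dotC phi) gphi mulr0 add0r dotC.
  move: dot0; rewrite {1}(uE X) iter_half_stepD -/g dotDl dotZl (dotC phi) (uu Y).2.
  by rewrite mulrAC => /eqP; rewrite addrC addr_eq0 => /eqP.
(* The cancelling term is at most the decayed norm of [g] times the norm of [f Y], which [vol_lt]
   makes too small. *)
have := sum_cauchy_schwarz (g 0) (f Y 0).
rewrite -/(dot g (f Y)) gf.
have sqr_dot h : \sum_i h 0 i ^+ 2 = dot h h by apply: eq_bigr => i _; rewrite expr2.
rewrite !sqr_dot ff => le1.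
have vol_ge0 Z : 0 <= vol Z by rewrite ler0n.
have rate_ge0 : 0 <= rate ^+ k by rewrite exprn_ge0 // le_max lexx.
rewrite ff in g_le.
have : (vol X * vol Y) ^+ 2 <= vol X * vol Y * (rate ^+ k * (vol (~: X) * vol (~: Y))).
  have : (vol X * vol Y / W) ^+ 2
      <= rate ^+ k * (vol X * vol (~: X) / W) * (vol Y * vol (~: Y) / W).
    rewrite -sqrrN; apply: le_trans le1 _; apply: ler_wpM2r g_le.
    by rewrite !mulr_ge0 ?invr_ge0 // ltW.
  rewrite expr_div_n ler_pdivrMr ?exprn_gt0 //; congr (_ <= _).
  by field; rewrite gt_eqF.
have xy_gt0 : 0 < vol X * vol Y by apply: le_lt_trans vol_lt; rewrite !mulr_ge0.
by rewrite expr2 ler_pM2l // leNgt vol_lt.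
Qed.

End EulerianDigraph.

(** * The digraph of ordered s-tuples *)

Section Tuples.
Variables (V : finType) (E : {set {set V}}) (r s : nat).
Hypotheses (unifE : uniform r E) (r_lt : (r < 2 * s)%N) (s_le : (s <= r - 1)%N).
Implicit Types x y : falling V s.

Lemma size_falling x : size (val x) = s.
Proof. exact: size_tuple. Qed.

Lemma card_supp x : #|supp x| = s.
Proof. by rewrite /supp cardsE (card_uniqP (valP x)) size_falling. Qed.

Lemma in_supp x v : (v \in supp x) = (v \in tval (val x)).
Proof. by rewrite inE. Qed.

Lemma mem_take_drop n x v :
  (v \in val x) = (v \in take n (val x)) || (v \in drop n (val x)).
Proof. by rewrite -mem_cat cat_take_drop. Qed.

Lemma falling_of_seq (w : seq V) :
  size w = s -> uniq w -> exists x, val x = w :> seq V.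
Proof.
move=> /eqP ws wu; pose t : s.-tuple V := Tuple ws.
by exists (exist (fun t : s.-tuple V => uniq t) t wu).
Qed.

(** The vertex sequence of the walk with stops [x :: p]: consecutive stops overlap, so each one but
    the last contributes only its first [r - s] entries. *)
Fixpoint unroll x (p : seq (falling V s)) : seq V :=
  if p is y :: p' then take (r - s) (val x) ++ unroll y p' else val x.

Lemma size_unroll x p : size (unroll x p) = ((r - s) * size p + s)%N.
Proof.
elim: p x => [|y p IHp] x /=; first by rewrite muln0 size_falling.
rewrite size_cat IHp size_take size_falling.
by rewrite mulnS addnA; case: ltnP => //; lia.
Qed.

(** After [r - s] entries of [x] comes a prefix of the next stop, which by [dedge] is the rest of
    [x]. *)
Lemma take_unroll x p : path (@dedge V E r s) x p -> take s (unroll x p) = val x.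
Proof.
elim: p x => [|y p IHp] x /=; first by rewrite take_oversize ?size_falling.
case/andP=> /andP[/eqP ov _] /IHp yE.
rewrite take_cat size_take size_falling.
have -> : (if (r - s < s)%N then (r - s)%N else s) = (r - s)%N by case: ltnP; lia.
rewrite ifF; last by lia.
rewrite -[RHS](cat_take_drop (r - s)); congr (_ ++ _).
rewrite ov -yE take_takel; last by lia.
by congr take; lia.
Qed.

Lemma drop_unroll x p i : (i <= size p)%N ->
  drop ((r - s) * i) (unroll x p) = unroll (nth x (x :: p) i) (drop i p).
Proof.
elim: i x p => [|i IHi] x [|y p]; rewrite ?muln0 ?drop0 // [size _]/= ltnS.
move=> ip /=; rewrite mulnS addnC -drop_drop drop_size_cat; last first.
  by rewrite size_take size_falling; case: ltnP; lia.
by rewrite IHi //; case: i {IHi} ip => //= i ip; rewrite (set_nth_default y).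
Qed.

Lemma dpath_path_between x p :
  path (@dedge V E r s) x p -> uniq (x :: p) -> path_between E r (size p) x (last x p).
Proof.
move=> xp xpu; exists (unroll x p).
have sub i : (i <= size p)%N ->
    path (@dedge V E r s) (nth x (x :: p) i) (drop i p).
  elim: i x p xp {xpu} => [|i IHi] x [|y p] //= /andP[_ yp] ip.
  by have := IHi y p yp ip; rewrite (set_nth_default y) //=; lia.
have stopE i : (i <= size p)%N -> stop r s (unroll x p) i = val (nth x (x :: p) i).
  by move=> ip; rewrite /stop drop_unroll // take_unroll // sub.
split; last 2 first.
- by rewrite stopE.
- by rewrite stopE // nth_last.
split; last first.
  have -> : [seq stop r s (unroll x p) i | i <- iota 0 (size p).+1]
          = [seq val (val z) | z <- x :: p].
    apply: (@eq_from_nth _ [::]); rewrite !size_map size_iota // => i ip.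
    rewrite (nth_map 0%N) ?size_iota // nth_iota // add0n stopE //.
    by rewrite [RHS](nth_map x [::]).
  by rewrite map_inj_uniq // => a b /val_inj/val_inj.
split; first exact: size_unroll.
move=> i ip; rewrite drop_unroll; last by lia.
have := sub i (ltnW ip); rewrite (drop_nth x ip) /=.
set a := nth x (x :: p) i; set b := nth x p i; case/andP=> /andP[/eqP ov ab] bp.
(* The entries of [a] beyond the first [r - s] reappear at the start of [b], so this window has
   underlying set [supp a :|: supp b]. *)
suff -> : take r (take (r - s) (val a) ++ unroll b (drop i.+1 p))
    = take (r - s) (val a) ++ val b.
  move: ab; congr (_ \in E); apply/setP => v; rewrite !inE mem_cat.
  rewrite (mem_take_drop (r - s) a) ov -orbA; congr (_ || _).
  by apply/orb_idl => /mem_take.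
rewrite take_cat size_take size_falling.
have -> : (if (r - s < s)%N then (r - s)%N else s) = (r - s)%N by case: ltnP; lia.
rewrite ifF; last by lia.
by congr (_ ++ _); rewrite -[RHS](take_unroll bp); congr take; lia.
Qed.

(** The first and last [s] entries of each window of [r] vertices are consecutive stops. By
    uniformity the window's [r] entries fill an edge of size [r], so none repeats and the stops are
    tuples of distinct vertices. *)
Lemma path_between_connect k x y :
  path_between E r k x y -> connect (@dedge V E r s) x y.
Proof.
case=> w [[[sw wE] _] w0 wk].
suff {wk} H i : (i <= k)%N ->
    exists2 z : falling V s, val z = stop r s w i :> seq V
      & connect (@dedge V E r s) x z.
  have [z zE xz] := H k (leqnn k).
  by rewrite (_ : y = z) //; apply/val_inj/val_inj; rewrite /= zE wk.
elim: i => [_|i IHi ik]; first by exists x; rewrite ?w0 ?connect0.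
have [z zE xz] := IHi (ltnW ik).
pose u := drop ((r - s) * i) w; pose F := take r u.
have su : (r <= size u)%N.
  rewrite size_drop sw.
  have : ((r - s) * i.+1 <= (r - s) * k)%N by rewrite leq_mul2l ik orbT.
  by rewrite mulnS; lia.
have sF : size F = r by rewrite size_takel.
have FE : [set v in F] \in E by exact: wE.
have uF : uniq F by apply/card_uniqP; rewrite sF -(unifE FE) cardsE.
have s1 : stop r s w i.+1 = drop (r - s) F.
  rewrite /stop /F mulnS -drop_drop /u take_drop; congr (drop _ (take _ _)); lia.
have s0 : stop r s w i = take s F by rewrite /stop /F take_takel //; lia.
have [z' z'E] : exists z' : falling V s, val z' = drop (r - s) F :> seq V.
  apply: falling_of_seq; first by rewrite size_drop sF; lia.
  exact: drop_uniq.
exists z'; first by rewrite s1.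
apply: connect_trans xz (connect1 _); apply/andP; split.
  rewrite zE s0 z'E; apply/eqP; rewrite take_drop; congr (drop _ (take _ _)); lia.
suff -> : supp z :|: supp z' = [set v in F] by [].
apply/setP => v; rewrite finset.in_setU !in_supp finset.inE zE s0 z'E; apply/orP/idP.
  by case=> [/mem_take|/mem_drop].
rewrite -{1}(cat_take_drop (r - s) F) mem_cat => /orP[vF|->]; last by right.
left; rewrite (_ : take (r - s) F = take (r - s) (take s F)) in vF.
  exact: mem_take vF.
by rewrite take_takel //; lia.
Qed.

(** The overlap fixes the first [2 * s - r] entries of [y]; the other [r - s] form an ordering of
    [e :\: supp x], which has [r - s] elements. *)
Lemma card_dedge_extension x (e : {set V}) :
  #|e| = r -> supp x \subset e ->
  #|[set y : falling V s | (drop (r - s) (val x) == take (2 * s - r) (val y))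
             && (supp x :|: supp y == e)]| = (r - s)`!.
Proof.
move=> er xe.
pose A := [set t : (r - s).-tuple V | all (mem (e :\: supp x)) t & uniq t].
have cA : #|A| = (r - s)`!.
  have := card_uniq_tuples (r - s) (mem (e :\: supp x)).
  rewrite -/A => ->.
  have -> : #|mem (e :\: supp x)| = #|e :\: supp x| by apply: eq_card.
  by rewrite cardsD (finset.setIidPr xe) er card_supp ffactnn.
(* For [t] in [A] the default values of [insubd] are never reached, by [extE]. *)
pose ext (t : (r - s).-tuple V) : falling V s :=
  insubd x (insubd (val x) (drop (r - s) (val x) ++ t)).
have extE t : t \in A -> val (ext t) = drop (r - s) (val x) ++ t :> seq V.
  rewrite inE => /andP[/allP tA tu].
  have st : size (drop (r - s) (val x) ++ t) == s.
    by rewrite size_cat size_drop size_falling size_tuple; apply/eqP; lia.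
  have vt : val (insubd (val x) (drop (r - s) (val x) ++ t))
     = drop (r - s) (val x) ++ t :> seq V by rewrite val_insubd st.
  rewrite /ext val_insubd vt cat_uniq drop_uniq ?(valP x) // tu andbT /=.
  rewrite ifT ?vt //; apply/hasPn => v /tA /=; rewrite !inE.
  by case/andP=> + _; apply: contra => /mem_drop.
rewrite -cA -(card_in_imset (f := ext)); last first.
  move=> t1 t2 /extE e1 /extE e2 /(congr1 (fun z => tval (val z))).
  rewrite e1 e2 => /eqP.
  by rewrite eqseq_cat // eqxx => /eqP/val_inj.
apply: eq_card => y; rewrite inE; apply/andP/imsetP.
  case=> /eqP ov /eqP ye.
  have ysplit : val y = drop (r - s) (val x) ++ drop (2 * s - r) (val y) :> seq V.
    by rewrite ov cat_take_drop.
  have st : size (drop (2 * s - r) (val y)) == (r - s)%N.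
    by rewrite size_drop size_falling; apply/eqP; lia.
  pose t : (r - s).-tuple V := Tuple st.
  have memy v : (v \in val y) = (v \in drop (r - s) (val x)) || (v \in t).
    by rewrite (mem_take_drop (2 * s - r) y) ov.
  (* By counting: [s + (r - s)] entries cover the [r] vertices of [e], so none repeats. *)
  have xt_uniq : uniq (val x ++ t).
    apply/card_uniqP; rewrite size_cat size_falling size_tuple.
    transitivity #|e|; last by rewrite er; lia.
    rewrite -ye; apply: eq_card => v; rewrite !inE mem_cat memy orbA; congr (_ || _).
    by apply/esym/orb_idr => /mem_drop.
  exists t.
    move: xt_uniq; rewrite cat_uniq inE => /and3P[_ /hasPn xt ->]; rewrite andbT.
    apply/allP => v vt; rewrite !inE (xt _ vt) /= -ye !inE memy.
    by rewrite vt !orbT.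
  apply/val_inj/val_inj => /=; rewrite [RHS]extE //; rewrite inE.
  move: xt_uniq; rewrite cat_uniq => /and3P[_ /hasPn xt ->]; rewrite andbT.
  apply/allP => v vt; rewrite !inE (xt _ vt) /= -ye !inE memy.
  by rewrite vt !orbT.
case=> t tA ->; rewrite extE //; split.
  rewrite take_size_cat //; rewrite size_drop size_falling; lia.
move: (tA); rewrite inE => /andP[/allP tD tu].
have -> : supp x :|: supp (ext t) = [set v in val x ++ t].
  apply/setP => v; rewrite finset.in_setU !in_supp finset.inE (extE _ tA) !mem_cat.
  by rewrite orbA; congr (_ || _); apply/orb_idr => /mem_drop.
rewrite eqEcard er cardsE; apply/andP; split.
  apply/fintype.subsetP => v; rewrite inE mem_cat => /orP[vx|/tD].
    by apply: (fintype.subsetP xe); rewrite inE.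
  by rewrite !inE => /andP[].
rewrite (card_uniqP _) ?size_cat ?size_falling ?size_tuple; first by lia.
rewrite cat_uniq (valP x) tu andbT /=; apply/hasPn => v /tD.
by rewrite !inE => /andP[].
Qed.

(** Each out-neighbour [y] is charged to the single edge [supp x :|: supp y], and
    [card_dedge_extension] counts those charged to a given edge. *)
Lemma out_degree x : (\sum_y dedge E r x y)%N = ddeg E r x.
Proof.
rewrite /ddeg /codeg -sum_nat_const.
rewrite (eq_bigr (fun y => \sum_(e in [set e in E | supp x \subset e])
    ((drop (r - s) (val x) == take (2 * s - r) (val y))
      && (supp x :|: supp y == e)))%N); last first.
  move=> y _; rewrite /dedge; case: eqP => _ /=; last by rewrite big1.
  have [xyE|xyE] := boolP (supp x :|: supp y \in E).
    rewrite (bigD1 (supp x :|: supp y)) /= ?inE ?xyE ?finset.subsetUl //.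
    rewrite eqxx big1 ?addn0 // => e /andP[_].
    by rewrite eq_sym => /negPf ->.
  rewrite big1 // => e; rewrite inE => /andP[eE _].
  by case: eqP => // ee; rewrite ee eE in xyE.
rewrite exchange_big /=; apply: eq_bigr => e; rewrite inE => /andP[eE xe].
rewrite -(card_dedge_extension (unifE eE) xe) cardsE -sum1_card [RHS]big_mkcond /=.
by apply: eq_bigr => y _; rewrite unfold_in; case: ifP.
Qed.

Fact rev_falling_subproof x : uniq (rev_tuple (val x)).
Proof. by rewrite /= rev_uniq (valP x). Qed.

Definition rev_falling x : falling V s :=
  exist (fun t : s.-tuple V => uniq t) _ (rev_falling_subproof x).

Lemma rev_fallingK : involutive rev_falling.
Proof. by move=> x; apply/val_inj/val_inj; rewrite /= revK. Qed.

Lemma supp_rev x : supp (rev_falling x) = supp x.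
Proof. by apply/setP => v; rewrite !inE /= mem_rev. Qed.

Lemma dedge_rev x y : dedge E r (rev_falling y) (rev_falling x) = dedge E r x y.
Proof.
rewrite /dedge !supp_rev finset.setUC /=; congr (_ && _).
rewrite drop_rev take_rev !size_falling.
rewrite (inj_eq (can_inj revK)) eq_sym; congr (drop _ _ == take _ _); lia.
Qed.

(* Reversing tuples reverses the edges of D^(s), so in-degrees are out-degrees. *)
Lemma in_degree y : (\sum_x dedge E r x y)%N = ddeg E r y.
Proof.
rewrite (reindex_inj (can_inj rev_fallingK)) /=.
rewrite -{1}(rev_fallingK y).
under eq_bigr do rewrite dedge_rev.
by rewrite out_degree /ddeg supp_rev.
Qed.

Lemma dedge_ddeg_gt0 x y : dedge E r x y -> (0 < ddeg E r x)%N.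
Proof. by move=> xy; rewrite -out_degree (bigD1 y) //= xy. Qed.

End Tuples.

(* If [2 <= l], the junk values [2 / 0 = 0] and [ln x = 0] for [x <= 0] make the
   bound collapse to [1], which is enough as [Num.max 0 (1 - l / 2)] is then 0. *)
Lemma floor_ln_bound (R : realType) (l a b : R) :
  let K : int := Num.floor (ln (a / b) / ln (2 / (2 - l))) + 1 in
  0 < l -> 0 <= a -> 0 < b -> b <= a \/ 0 <= K ->
  exists2 k : nat, K = k & Num.max 0 (1 - l / 2) ^+ k * a < b.
Proof.
move=> K l_gt0 a_ge0 b_gt0 hK.
have [l_ge2|l_lt2] := leP 2 l.
  exists 1%N.
    rewrite /K [ln (2 / _)]ln0 ?invr0 ?mulr0 ?floor0 //.
    by rewrite mulr_ge0_le0 ?invr_le0 //; lra.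
  by rewrite expr1 max_l ?mul0r //; lra.
pose t : R := 2 / (2 - l).
have t_gt1 : 1 < t by rewrite ltr_pdivlMr ?mul1r; lra.
have t_gt0 : 0 < t by apply: lt_trans t_gt1.
have lnt_gt0 : 0 < ln t by rewrite ln_gt0.
have rateE : Num.max 0 (1 - l / 2) = t^-1.
  rewrite max_r; last by lra.
  by rewrite /t; field; rewrite gt_eqF //; lra.
have K_ge0 : 0 <= K.
  case: hK => // ba; rewrite addr_ge0 // floor_ge0 mulr_ge0 ?invr_ge0 ?(ltW lnt_gt0) //.
  by rewrite ln_ge0 // ler_pdivlMr ?mul1r.
exists `|K|%N; first by rewrite gez0_abs.
have [->|a_neq0] := eqVneq a 0; first by rewrite mulr0.
have a_gt0 : 0 < a by rewrite lt_neqAle eq_sym a_neq0.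
(* The [+ 1] outside the floor supplies strictness. The case [a = 0] was set apart because [ln]
   reflects order only on positive reals. *)
have : ln (a / b) / ln t < K%:~R.
  by rewrite /K -/t floorD1_gt ?num_real.
rewrite -{1}(gez0_abs K_ge0) ltr_pdivrMr // -[_%:~R]/(`|K|%:R) mulr_natl.
rewrite -lnXn // ltr_ln ?posrE ?divr_gt0 ?exprn_gt0 // => abt.
rewrite rateE exprVn mulrC ltr_pdivrMr ?exprn_gt0 //.
by move: abt; rewrite ltr_pdivrMr // mulrC.
Qed.

(** * Consequences of s-connectedness *)

Section Digraph.
Variables (R : realType) (V : finType) (r s : nat) (E : {set {set V}}).
Hypotheses (unifE : uniform r E) (r_lt : (r < 2 * s)%N) (s_le : (s <= r - 1)%N).
Hypothesis connE : s_connected R E r s.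
Implicit Types (x y : falling V s) (X Y : {set falling V s}).

(** The bounds on [s] force [2 <= s], so the first and last entries differ. Reversal thus supplies a
    second tuple next to any given one. *)
Lemma rev_falling_neq x : rev_falling x != x.
Proof.
apply/negP => /eqP /(congr1 (fun z => tval (val z))) /= xE.
have v0 : V by case: (tval (val x)) (size_falling x) => //= ; lia.
have := congr1 (fun w => nth v0 w 0) xE.
rewrite nth_rev size_falling; last by lia.
move/eqP; rewrite nth_uniq ?size_falling ?(valP x) //; lia.
Qed.

Lemma dist_path_between x y :
  (dist R E r x y < +oo)%E -> exists k, path_between E r k x y.
Proof.
move=> xy; apply: contrapT => no_path; move: xy; rewrite /dist.
suff -> : [set k | path_between E r k x y]%classic = classical_sets.set0.
  by rewrite image_set0 ereal_inf0 ltxx.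
by apply/seteqP; split=> // k xk; apply: no_path; exists k.
Qed.

Lemma s_connected_connect x y : connect (@dedge V E r s) x y.
Proof.
by have [k] := dist_path_between (connE x y); apply: path_between_connect.
Qed.

(** A walk from [x] to its reversal, a different tuple, must begin with an edge leaving [x]. *)
Lemma ddeg_gt0 x : (0 < ddeg E r x)%N.
Proof.
have /connectP[[|z p]] := s_connected_connect x (rev_falling x).
  by move=> _ /= /eqP; rewrite (negPf (rev_falling_neq x)).
by case/andP=> xz _ _; apply: dedge_ddeg_gt0 xz.
Qed.

Lemma vol_gt0 X : X != finset.set0 -> (0 < vol E r X)%N.
Proof.
case/set0Pn=> x xX; rewrite /vol (bigD1 x) //=.
by rewrite addn_gt0 ddeg_gt0.
Qed.

(** Matrices are indexed by ordinals, so the digraph is transported along [enum_val]. *)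
Let I := 'I_#|{: falling V s}|.
Let e : rel I := fun i j => dedge E r (enum_val i) (enum_val j).
Let d (i : I) : nat := ddeg E r (enum_val i).

Let sum_enum_val (F : falling V s -> nat) (P : pred (falling V s)) :
  (\sum_(i : I | P (enum_val i)) F (enum_val i) = \sum_(x | P x) F x)%N.
Proof.
rewrite [RHS](reindex (enum_val : I -> falling V s)) //.
exact: onW_bij (enum_val_bij _).
Qed.

Let e_out i : (\sum_j e i j)%N = d i.
Proof. by rewrite (sum_enum_val (fun y => dedge E r _ y : nat) predT) out_degree. Qed.

Let e_in j : (\sum_i e i j)%N = d j.
Proof. by rewrite (sum_enum_val (fun x => dedge E r x _ : nat) predT) in_degree. Qed.

Let e_connect i j : connect e i j.
Proof.
have /connectP[p ip jE] := s_connected_connect (enum_val i) (enum_val j).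
apply/connectP; exists (map enum_rank p); last first.
  by rewrite -(enum_valK i) last_map -jE enum_valK.
rewrite -(enum_valK i) path_map; apply: sub_path ip => x y.
by rewrite /e /= !enum_rankK.
Qed.

Let card_gt1 X : X != finset.set0 -> (1 < #|{: falling V s}|)%N.
Proof.
case/set0Pn=> x _; apply/card_gt1P.
by exists (rev_falling x), x; rewrite rev_falling_neq.
Qed.

Lemma lambda1_gt0 X : X != finset.set0 -> 0 < lambda R E r s 1.
Proof.
move=> /card_gt1.
exact: (@digraph_lambda1_gt0 R _ e d (fun i => ddeg_gt0 _) e_out e_in e_connect).
Qed.

Lemma short_dpath X Y k : X != finset.set0 ->
  Num.max 0 (1 - lambda R E r s 1 / 2) ^+ k
    * ((vol E r (~: X))%:R * (vol E r (~: Y))%:R)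
  < (vol E r X)%:R * (vol E r Y)%:R ->
  exists x p, [/\ x \in X, last x p \in Y,
    path (@dedge V E r s) x p & (size p <= k)%N].
Proof.
move=> /card_gt1 n_gt1 lt_vol.
pose pull X : {set I} := [set i | enum_val i \in X].
have volE Z : vol E r Z = (\sum_(i in pull Z) d i)%N.
  rewrite /vol -(sum_enum_val (@ddeg V E r s) (fun x => x \in Z)).
  by apply: eq_bigl => i; rewrite finset.inE.
have pullC Z : pull (~: Z) = ~: pull Z by apply/setP => i; rewrite !inE.
have := @digraph_short_path R _ e d (fun i => ddeg_gt0 _) e_out e_in e_connect
  n_gt1 (pull X) (pull Y) k.
rewrite -!pullC -!volE => /(_ lt_vol)[i [p [iX pY ip pk]]].
exists (enum_val i), (map enum_val p); split; last by rewrite size_map.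
- by rewrite inE in iX.
- by rewrite last_map; rewrite inE in pY.
- by rewrite path_map.
Qed.

End Digraph.

(** If [X] or [Y] is empty the distance is infinite. If they meet it is 0, while the logarithm can
    be negative enough to make the bound negative; hence the alternative of disjointness or a
    nonnegative bound. *)
Theorem theorem13 (R : realType) (V : finType) (r s : nat)
    (E : {set {set V}}) (X Y : {set falling V s}) :
  uniform r E ->
  (r < 2 * s)%N -> (s <= r - 1)%N ->
  s_connected R E r s ->
  X != finset.set0 -> Y != finset.set0 ->
  let bound : int :=
    Num.floor
      (ln ((vol E r (~: X))%:R * (vol E r (~: Y))%:R /
           ((vol E r X)%:R * (vol E r Y)%:R)) /
       ln (2 / (2 - lambda R E r s 1))) + 1 in
  [disjoint X & Y] \/ 0 <= bound ->
  (set_dist R E r X Y <= bound%:~R%:E)%E.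
Proof.
move=> unifE r_lt s_le connE X0 Y0 bound hbound.
have l_gt0 := lambda1_gt0 unifE r_lt s_le connE X0.
have volX := vol_gt0 unifE r_lt s_le connE X0.
have volY := vol_gt0 unifE r_lt s_le connE Y0.
have [|||k boundE lt_vol] := @floor_ln_bound R _
    ((vol E r (~: X))%:R * (vol E r (~: Y))%:R)
    ((vol E r X)%:R * (vol E r Y)%:R) l_gt0.
- by rewrite mulr_ge0.
- by rewrite mulr_gt0 ?ltr0n.
(* Disjointness puts [Y] inside [~: X] and [X] inside [~: Y], so the volume ratio is at least 1. *)
- case: hbound => [XY|]; [left | by right].
  rewrite -!natrM ler_nat mulnC; apply: leq_mul; rewrite /vol.
    rewrite [leqRHS](bigID (mem Y)) /=; apply: leq_trans (leq_addr _ _).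
    apply/eq_leq/eq_bigl => y; rewrite !inE.
    case yY: (y \in Y); rewrite ?andbF // andbT.
    by rewrite (disjointFl XY yY).
  rewrite [leqRHS](bigID (mem X)) /=; apply: leq_trans (leq_addr _ _).
  apply/eq_leq/eq_bigl => x; rewrite !inE.
  case xX: (x \in X); rewrite ?andbF // andbT.
  by rewrite (disjointFr XY xX).
have [x [p [xX pY xp pk]]] := short_dpath unifE r_lt s_le connE X0 lt_vol.
(* An s-path needs distinct stops, so the walk is cut down to a loop-free one, which is no
   longer. *)
rewrite [bound]boundE; move: pY; case/shortenP: xp => q xq uq qp qY.
apply: (@le_trans _ _ (dist R E r x (last x q))).
  by apply: ereal_inf_lbound; exists (x, last x q).
apply: (@le_trans _ _ (size q)%:R%:E).
  by apply: ereal_inf_lbound; exists (size q) => //; apply: dpath_path_between.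
rewrite lee_fin ler_nat; apply: leq_trans pk.
by apply: uniq_leq_size => //; case/andP: uq.
Qed.
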